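(* Let $K$ be a field of characteristic $p>0$, let $k=\bigcap_{n\ge0}K^{p^n}$ be its perfection, and assume $K/k$ is a finitely generated field extension. Then the following three sets are in natural bijection: (1) power towers on $K$; (2) Jacobson sequences on $K$; (3) $K$-subalgebras of $\operatorname{Diff}_k(K)$ (subrings containing the multiplication operators by elements of $K$). Explicitly, the following maps are well defined and give mutually inverse bijections between (1) and (2), and between (1) and (3): - (1)$\to$(2): $(W_0,W_1,W_2,\ldots)\mapsto (T_{W_0/W_1},T_{W_1/W_2},T_{W_2/W_3},\ldots)$; - (2)$\to$(1): $(\mathcal F_1,\mathcal F_2,\ldots)\mapsto (K,\operatorname{Ann}(\mathcal F_1),\operatorname{Ann}(\mathcal F_2),\ldots)$; - (1)$\to$(3): $W_\bullet\mapsto \bigcup_{i\ge0}\operatorname{Diff}_{W_i}(K)$; - (3)$\to$(1): $\mathcal D\mapsto(\operatorname{const}(\mathcal D_0),\operatorname{const}(\mathcal D_1),\operatorname{const}(\mathcal D_2),\ldots)$, where $\mathcal D_n=\mathcal D\cap\operatorname{Diff}_{K^{p^n}}(K)$.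
   Context: $K^{p^n}=\{x^{p^n}:x\in K\}$; $A\cdot B$ is the composite of subfields. A power tower on $K$ is a sequence of subfields $W_0,W_1,\ldots$ of $K$ with $W_j=W_i\cdot K^{p^j}$ for all $0\le j\le i$. For a subring $L\subset R$, $\operatorname{Diff}_L(R)\subset\operatorname{End}_L(R)$ is the ring of Grothendieck differential operators: $F_{-1}=0$, $F_d=\{D\in\operatorname{End}_L(R):[D,f]\in F_{d-1}\ \forall f\in R\}$ ($f$ = multiplication by $f$), $\operatorname{Diff}_L(R)=\bigcup_d F_d$. For fields $A\supset B$, $T_{A/B}=\operatorname{Der}_B(A)$, the $B$-linear derivations $A\to A$. A $p$-Lie algebra on a field $L$ (of characteristic $p$) is an $L$-subspace of $T_{L/L^p}$ closed under the commutator $[D,E]=D\circ E-E\circ D$ and under $D\mapsto D^{\circ p}$. For a set $\mathcal F$ of derivations of $L$, $\operatorname{Ann}(\mathcal F)=\{x\in L: D(x)=0\ \forall D\in\mathcal F\}$. A Jacobson sequence on $K$ is a sequence $(\mathcal F_1,\mathcal F_2,\ldots)$ such that $\mathcal F_1$ is a $p$-Lie algebra on $K$, and for each $i\ge1$, $\mathcal F_{i+1}$ is a $p$-Lie algebra on $\operatorname{Ann}(\mathcal F_i)$ satisfying $\mathcal F_{i+1}\cap T_{\operatorname{Ann}(\mathcal F_i)/\operatorname{Ann}(\mathcal F_{i-1})^p}=0$, where $\operatorname{Ann}(\mathcal F_0):=K$. For a set $\mathcal D$ of operators on $K$, $\operatorname{const}(\mathcal D)=\{x\in K: D\circ x=x\circ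 D\ \forall D\in\mathcal D\}$. *)

(* Defs.v *)
From mathcomp Require Import all_boot all_order all_algebra.
Set Implicit Arguments. Unset Strict Implicit. Unset Printing Implicit Defensive.
Import GRing.Theory.
Local Open Scope ring_scope.

Section Defs.
Variable K : fieldType.

Definition kset (T : Type) := T -> Prop.

Definition is_subfield (S : kset K) : Prop :=
  [/\ S 0, S 1,
      (forall x y, S x -> S y -> S (x - y)),
      (forall x y, S x -> S y -> S (x * y)) &
      (forall x, S x -> S x^-1)].

Definition Kpow (p n : nat) : kset K := fun x => exists y : K, x = y ^+ (p ^ n).

Definition powset (L : kset K) (p : nat) : kset K :=
  fun x => exists y, L y /\ x = y ^+ p.

Definition perfection (p : nat) : kset K := fun x => forall n, Kpow p n x.

Definition composite (A B : kset K) : kset K :=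
  fun x => forall S, is_subfield S -> (forall a, A a -> S a) ->
                     (forall b, B b -> S b) -> S x.

Definition fin_gen_over (k : kset K) : Prop :=
  exists s : seq K, forall S, is_subfield S -> (forall a, k a -> S a) ->
                              (forall x, x \in s -> S x) -> forall x, S x.

Definition power_tower (p : nat) (W : nat -> kset K) : Prop :=
  (forall i, is_subfield (W i)) /\
  (forall i j, (j <= i)%N -> W j = composite (W i) (Kpow p j)).

(* T_{A/B} = Der_B(A): B-linear derivations A -> A.  A derivation of the
   subfield A is encoded as a map D : K -> K which maps A into A and is zero
   outside A (so that equality of derivations is extensional equality). *)
Definition Der (A B : kset K) : kset (K -> K) := fun D =>
  [/\ (forall x, ~ A x -> D x = 0),
      (forall x, A x -> A (D x)),
      (forall x y, A x -> A y -> D (x + y) = D x + D y),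
      (forall x y, A x -> A y -> D (x * y) = x * D y + D x * y) &
      (forall b x, B b -> A x -> D (b * x) = b * D x)].

Definition zero_op : K -> K := fun _ => 0.

Definition pLie (p : nat) (L : kset K) (F : kset (K -> K)) : Prop :=
  (forall D, F D -> Der L (powset L p) D) /\
  [/\ F zero_op,
      (forall D E, F D -> F E -> F (fun x => D x + E x)),
      (forall a D, L a -> F D -> F (fun x => a * D x)),
      (forall D E, F D -> F E -> F (fun x => D (E x) - E (D x))) &
      (forall D, F D -> F (iter p D))].

Definition Ann (L : kset K) (F : kset (K -> K)) : kset K :=
  fun x => L x /\ forall D, F D -> D x = 0.

(* For a sequence F with F i = \mathcal F_{i+1}:
   AnnSeq F i = Ann(\mathcal F_i), with Ann(\mathcal F_0) = K. *)
Fixpoint AnnSeq (F : nat -> kset (K -> K)) (i : nat) : kset K :=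
  match i with
  | 0 => fun _ => True
  | i'.+1 => Ann (AnnSeq F i') (F i')
  end.

Definition setI_op (A B : kset (K -> K)) : kset (K -> K) := fun D => A D /\ B D.

(* Jacobson sequence, indexed so that F i = \mathcal F_{i+1} *)
Definition jacobson_seq (p : nat) (F : nat -> kset (K -> K)) : Prop :=
  pLie p (AnnSeq F 0) (F 0) /\
  forall m, (0 < m)%N ->
    pLie p (AnnSeq F m) (F m) /\
    setI_op (F m) (Der (AnnSeq F m) (powset (AnnSeq F m.-1) p))
      = (fun D => D = zero_op).

Definition mulop (f : K) : K -> K := fun x => f * x.

Definition End_over (L : kset K) : kset (K -> K) := fun D =>
  (forall x y, D (x + y) = D x + D y) /\
  (forall l x, L l -> D (l * x) = l * D x).

Definition commf (D : K -> K) (f : K) : K -> K := fun x => D (f * x) - f * D x.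

(* diffF L n = F_{n-1}; F_{-1} = 0 *)
Fixpoint diffF (L : kset K) (n : nat) : kset (K -> K) :=
  match n with
  | 0 => fun D => D = zero_op
  | n'.+1 => fun D => End_over L D /\ forall f, diffF L n' (commf D f)
  end.

Definition Diff (L : kset K) : kset (K -> K) := fun D => exists n, diffF L n D.

Definition K_subalg_Diff (k : kset K) (DD : kset (K -> K)) : Prop :=
  [/\ (forall D, DD D -> Diff k D),
      (forall a, DD (mulop a)),
      (forall D E, DD D -> DD E -> DD (fun x => D x - E x)) &
      (forall D E, DD D -> DD E -> DD (fun x => D (E x)))].

Definition const (DD : kset (K -> K)) : kset K :=
  fun x => forall D, DD D -> (fun y => D (x * y)) = (fun y => x * D y).

Definition DD_n (p : nat) (DD : kset (K -> K)) (n : nat) : kset (K -> K) :=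
  fun D => DD D /\ Diff (Kpow p n) D.

Definition tower_to_alg (W : nat -> kset K) : kset (K -> K) :=
  fun D => exists i, Diff (W i) D.

End Defs.

(* Main.v *)
(* Under the hypotheses [K] is finite over every [K^(p^n)], and a differential operator
   of order less than [p^n] is [K^(p^n)]-linear because [ad (f^(p^n)) = (ad f)^(p^n)];
   conversely every endomorphism linear over [K^(p^n)] is a differential operator, since
   the [f] for which [ad f T] has bounded order form a subfield.  So (1) <-> (3) reduces to
   the Jacobson-Bourbaki correspondence at each level [n], and (1) <-> (2) to Jacobson's
   correspondence for [L^p <= B <= L].  Both rest on dual bases [D_i (y_j) = delta_ij]
   obtained by elimination.  In height one, the pairs (D_i, multiplication by y_i) acting
   on [L], and (ad y_i, right composition with D_i) acting on [End_B(L)], satisfy Weyl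
   relations with nilpotent first member, so a subgroup stable under the second member
   and containing the common kernel of the first is everything. *)
From HB Require Import structures.
From mathcomp Require Import all_boot all_order all_algebra.
From mathcomp Require Import boolp functions ring.
Require Import Defs.
Set Implicit Arguments. Unset Strict Implicit. Unset Printing Implicit Defensive.
Import GRing.Theory.
Local Open Scope ring_scope.

(** * Pascal recursions in characteristic [p] *)

Lemma pascal_sum (V : zmodType) (S : nat -> nat -> nat -> V) :
  (forall n i j, S n.+1 i j = S n i.+1 j + S n i j.+1) ->
  forall n i j,
    S n i j = \sum_(k < n.+1) S 0 (i + k)%N (j + (n - k))%N *+ 'C(n, k).
Proof.
move=> rec; elim=> [|n IHn] i j.
  by rewrite big_ord1 /= bin0 mulr1n !addn0.
rewrite rec !IHn [RHS]big_ord_recl /= bin0 addn0 subn0.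
under [in RHS]eq_bigr => k _ do
  rewrite /bump /= !add1n binS mulrnDr subSS.
rewrite big_split /= addrA [RHS]addrC; congr (_ + _).
  by apply: eq_bigr => k _; rewrite addSnnS.
rewrite big_ord_recl /= bin0 addn0 subn0 addSnnS; congr (_ + _).
rewrite big_ord_recr /= [X in _ *+ X]bin_small // mulr0n addr0.
apply: eq_bigr => k _; rewrite /bump /= !add1n addSnnS subnSK //.
Qed.

(** [S n] is the [n]-th power of a sum of two commuting shifts applied to [S 0], and the inner
    binomial coefficients vanish modulo [p]. This serves both for the [p]-th power of [ad f] and for
    that of a derivation. *)
Lemma pascal_pchar (K : fieldType) (p : nat) (S : nat -> nat -> nat -> K) :
  p \in [pchar K] ->
  (forall n i j, S n.+1 i j = S n i.+1 j + S n i j.+1) ->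
  forall i j, S p i j = S 0 (i + p)%N j + S 0 i (j + p)%N.
Proof.
move=> pK rec i j; have p_gt0 := prime_gt0 (pcharf_prime pK).
case: p pK p_gt0 => // p pK _.
rewrite (pascal_sum rec) big_ord_recl big_ord_recr /= bin0 /bump /= !add1n binn.
rewrite big1 ?add0r => [|k _]; last first.
  have lekp: (0 < k.+1 < p.+1)%N by rewrite /= ltnS ltn_ord.
  by rewrite -mulr_natr (bin_lt_pcharf_0 pK lekp) mulr0.
by rewrite addn0 subn0 !mulr1n subnn addn0 addrC.
Qed.

(** * Iterated commutators with multiplication operators *)

Section Commutators.
Variable K : fieldType.
Implicit Types (D E : K -> K) (L M : kset K).

Lemma commfC D f g : commf (commf D f) g = commf (commf D g) f.
Proof.
by apply/funext => x; rewrite /commf (mulrCA f g x); ring.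
Qed.

Lemma iter_commfC D f g n :
  iter n (fun T => commf T f) (commf D g) = commf (iter n (fun T => commf T f) D) g.
Proof. by elim: n => //= n ->; rewrite commfC. Qed.

Lemma commf0 f : commf (@zero_op K) f = @zero_op K.
Proof. by apply/funext => x; rewrite /commf /zero_op mulr0 subr0. Qed.

Lemma commf_pexp p D f : p \in [pchar K] ->
  iter p (fun T => commf T f) D = commf D (f ^+ p).
Proof.
move=> pK; apply/funext => x.
(* Here [i] counts left factors [- f] and [j] right factors [f]: [ad f] is the sum of these two
   commuting operations. *)
pose S n i j := (- f) ^+ i * iter n (fun T => commf T f) D (f ^+ j * x).
have recS n i j : S n.+1 i j = S n i.+1 j + S n i j.+1.
  by rewrite /S /= /commf !exprS -(mulrA f); ring.
have := pascal_pchar pK recS 0 0; rewrite /S /= !add0n !expr0 !mul1r => ->.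
rewrite /commf addrC; congr (_ + _).
by rewrite -mulNr -(pFrobenius_autE pK) rmorphN.
Qed.

Lemma commf_pexpn p D f n : p \in [pchar K] ->
  iter (p ^ n) (fun T => commf T f) D = commf D (f ^+ (p ^ n)).
Proof.
move=> pK; elim: n D f => // n IHn D f.
rewrite expnSr exprM -(commf_pexp _ _ pK).
suff -> m : iter (p ^ n * m) (fun T => commf T f) D
          = iter m (fun T => commf T (f ^+ (p ^ n))) D by [].
by elim: m => [|m IHm]; rewrite ?muln0 // mulnS iterD IHm IHn.
Qed.

End Commutators.

(** * Linear algebra over subfields given by predicates *)

Section Subfields.
Variable K : fieldType.
Implicit Types (S L M A : kset K) (D E T : K -> K).

Lemma subfield_opp S x : is_subfield S -> S x -> S (- x).
Proof. by case=> S0 _ SB _ _ Sx; rewrite -sub0r; apply: SB. Qed.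

Lemma subfield_add S x y : is_subfield S -> S x -> S y -> S (x + y).
Proof.
move=> sfS Sx Sy; rewrite -[y]opprK; case: (sfS) => _ _ SB _ _; apply: SB => //.
exact: subfield_opp.
Qed.

Lemma subfield_exp S x n : is_subfield S -> S x -> S (x ^+ n).
Proof. by case=> _ S1 _ SM _ Sx; elim: n => // n IHn; rewrite exprS; apply: SM. Qed.

Lemma End_over0 L T : End_over L T -> T 0 = 0.
Proof. by case=> TD _; apply: (@addrI _ (T 0)); rewrite -TD !addr0. Qed.

Lemma End_overB L T x y : End_over L T -> T (x - y) = T x - T y.
Proof.
move=> LT; apply: (@addIr _ (T y)); case: (LT) => TD _.
by rewrite -TD !subrK.
Qed.

Lemma End_over_sum L T (I : Type) (r : seq I) (F : I -> K) :
  End_over L T -> T (\sum_(i <- r) F i) = \sum_(i <- r) T (F i).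
Proof.
move=> LT; apply: (big_morph T) => [x y|]; first by case: LT.
exact: End_over0 LT.
Qed.

Lemma End_over_sub L M T : (forall x, M x -> L x) -> End_over L T -> End_over M T.
Proof. by move=> sML [TD TZ]; split=> // l x /sML; apply: TZ. Qed.

Lemma End_over_mulop L a : End_over L (mulop a).
Proof. by split=> [x y|l x _]; rewrite /mulop ?mulrDr // mulrCA. Qed.

Lemma End_over_subop L T E :
  End_over L T -> End_over L E -> End_over L (fun x => T x - E x).
Proof.
move=> [TD TZ] [ED EZ]; split=> [x y|l x Ll]; first by rewrite TD ED; ring.
by rewrite TZ // EZ // mulrBr.
Qed.

Lemma End_over_comp L T E :
  End_over L T -> End_over L E -> End_over L (fun x => T (E x)).
Proof.
move=> [TD TZ] [ED EZ]; split=> [x y|l x Ll]; first by rewrite ED TD.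
by rewrite EZ // TZ.
Qed.

Lemma End_over_zero L : End_over L (@zero_op K).
Proof. by split=> *; rewrite /zero_op ?addr0 ?mulr0. Qed.

Lemma End_over_commf L T f : End_over L T -> End_over L (commf T f).
Proof.
move=> LT; apply: End_over_subop.
  by apply: (End_over_comp LT); apply: End_over_mulop.
by apply: (@End_over_comp L (mulop f) T) => //; apply: End_over_mulop.
Qed.

(** The [M]-span of a list, unfolded head first: a mere predicate can provide the scalars, and
    elimination becomes induction on the list. *)
Fixpoint lspan M (s : seq K) : kset K :=
  if s is y :: t then fun x => exists2 m, M m & lspan M t (x - m * y)
  else fun x => x = 0.

Lemma lspan0 M s : is_subfield M -> lspan M s 0.
Proof.
by case=> M0 *; elim: s => //= y s IHs; exists 0; rewrite // mul0r subr0.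
Qed.

Lemma lspanD M s x y :
  is_subfield M -> lspan M s x -> lspan M s y -> lspan M s (x + y).
Proof.
move=> sfM; elim: s x y => /= [x y -> ->|z s IHs x y [m Mm xs] [n Mn ys]].
  by rewrite addr0.
exists (m + n); first exact: subfield_add.
by rewrite mulrDl opprD addrACA; apply: IHs.
Qed.

Lemma lspanZ M s a x :
  is_subfield M -> M a -> lspan M s x -> lspan M s (a * x).
Proof.
case=> _ _ _ MM _ Ma; elim: s x => /= [x ->|z s IHs x [m Mm xs]].
  by rewrite mulr0.
by exists (a * m); [apply: MM | rewrite -mulrA -mulrBr; apply: IHs].
Qed.

Lemma lspanB M s x y :
  is_subfield M -> lspan M s x -> lspan M s y -> lspan M s (x - y).
Proof.
move=> sfM xs ys; apply: lspanD => //; rewrite -mulN1r; apply: lspanZ => //.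
by apply: subfield_opp => //; case: sfM.
Qed.

Lemma lspan_mem M s x : is_subfield M -> x \in s -> lspan M s x.
Proof.
move=> sfM; elim: s => //= y s IHs; rewrite inE => /predU1P[->|xs].
  by exists 1; rewrite ?mul1r ?subrr; [case: sfM | apply: lspan0].
by exists 0; rewrite ?mul0r ?subr0; [case: sfM | apply: IHs].
Qed.

Lemma lspan_ind M s (P : K -> Prop) :
  P 0 -> (forall x y, P x -> P y -> P (x + y)) ->
  (forall m y, M m -> y \in s -> P (m * y)) -> forall x, lspan M s x -> P x.
Proof.
move=> P0 PD; elim: s => /= [_ x -> //|y s IHs Ps x [m Mm xs]].
rewrite -(subrK (m * y) x); apply: PD; last by apply: Ps; rewrite ?mem_head.
by apply: IHs xs => n z Mn zs; apply: Ps; rewrite ?inE ?zs ?orbT.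
Qed.

Lemma lspan_mono M L s x :
  (forall y, M y -> L y) -> lspan M s x -> lspan L s x.
Proof.
by move=> sML; elim: s x => //= y s IHs x [m /sML Lm xs]; exists m; auto.
Qed.

Lemma End_over_lspan_eq M s T E : End_over M T -> End_over M E ->
  (forall x, x \in s -> T x = E x) -> forall x, lspan M s x -> T x = E x.
Proof.
move=> MT ME TE; apply: lspan_ind => [|x y Tx Ty|m y Mm ys].
- by rewrite (End_over0 MT) (End_over0 ME).
- by case: MT ME => TD _ [ED _]; rewrite TD ED Tx Ty.
- by case: MT ME => _ TZ [_ EZ]; rewrite TZ // EZ // TE.
Qed.

(* [M[s]] is a ring containing the [q]-th powers of its elements in [M], hence a field. *)
Lemma finite_lspan M q (s : seq K) : is_subfield M -> (0 < q)%N ->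
    (forall x, M (x ^+ q)) ->
    (forall S, is_subfield S -> (forall a, M a -> S a) ->
       (forall x, x \in s -> S x) -> forall x, S x) ->
  exists t, forall x, lspan M t x.
Proof.
move=> sfM q_gt0 Mq gen_s.
have [t [t1 ts tM]] : exists t, [/\ lspan M t 1, forall x, x \in s -> lspan M t x &
    forall x y, lspan M t x -> lspan M t y -> lspan M t (x * y)].
  elim: s {gen_s} => [|x s [t [t1 ts tM]]].
    exists [:: 1]; split=> [|//|x y /= [m Mm /eqP]].
      by apply: lspan_mem; rewrite ?mem_head.
    rewrite subr_eq0 mulr1 => /eqP-> [n Mn /eqP].
    rewrite subr_eq0 mulr1 => /eqP->; exists (m * n); rewrite ?mulr1 ?subrr //.
    by case: sfM => _ _ _ MM _; apply: MM.
  (* Powers of [x] below [q] suffice, since [x ^+ q] is a scalar. *)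
  pose t' := [seq x ^+ i * u | i <- iota 0 q, u <- t]; exists t'.
  have t'x i w : lspan M t w -> lspan M t' (x ^+ i * w).
    rewrite (divn_eq i q) exprD mulnC exprM; move: w.
    apply: lspan_ind => [|u v IHu IHv|m y Mm yt]; first by rewrite mulr0; apply: lspan0.
      by rewrite mulrDr; apply: lspanD.
    rewrite -mulrA [x ^+ (i %% q) * _]mulrCA.
    apply: lspanZ => //; first exact: subfield_exp.
    apply: lspanZ => //.
    apply: lspan_mem => //; apply/allpairsP; exists (i %% q, y)%N; split=> //=.
    by rewrite mem_iota ltn_mod.
  have t't w : lspan M t w -> lspan M t' w.
    by move=> wt; rewrite -[w]mul1r -(expr0 x); apply: t'x.
  split; first exact: t't.
    move=> y; rewrite inE => /predU1P[->|/ts/t't//].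
    by rewrite -[x]mulr1 -{1}[x]expr1; apply: t'x.
  move=> u v ut vt; move: u ut.
  apply: lspan_ind => [|u w IHu IHw|m _ Mm /allpairsP[[i y] [/= _ yt ->]]].
  - by rewrite mul0r; apply: lspan0.
  - by rewrite mulrDl; apply: lspanD.
  rewrite -mulrA; apply: lspanZ => //; move: v vt.
  apply: lspan_ind => [|u w IHu IHw|n _ Mn /allpairsP[[j z] [/= _ zt ->]]].
  - by rewrite mulr0; apply: lspan0.
  - by rewrite mulrDr; apply: lspanD.
  rewrite mulrCA; apply: lspanZ => //; rewrite mulrACA -exprD.
  by apply: t'x; apply: tM; apply: lspan_mem.
exists t; apply: gen_s => // [|a Ma]; last by rewrite -[a]mulr1; apply: lspanZ.
split=> // [|x y xt yt|x xt]; [exact: lspan0 | exact: lspanB |].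
have [->|x0] := eqVneq x 0; first by rewrite invr0; apply: lspan0.
have -> : x^-1 = (x ^+ q)^-1 * x ^+ q.-1.
  by rewrite -[in x ^+ q](prednK q_gt0) exprS invfM -mulrA mulVf ?mulr1 ?expf_neq0.
apply: lspanZ => //; first by case: sfM => _ _ _ _; apply.
by elim: q.-1 => // n IHn; rewrite exprS; apply: tM.
Qed.

(** Echelon form: for each [y] of the list, at most one element of [A] with nonzero [y]-coefficient
    is kept; subtracting a multiple of it moves any other element of [A] into the span of the
    tail. *)
Lemma subspace_lspan M s A : is_subfield M ->
    (forall x y, A x -> A y -> A (x - y)) ->
    (forall m x, M m -> A x -> A (m * x)) ->
  exists t, (forall x, x \in t -> A x) /\
    forall x, A x -> lspan M s x -> lspan M t x.
Proof.
move=> sfM AB AZ; elim: s => [|y s [t [At st]]]; first by exists [::].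
case: (sfM) => _ _ _ MM MV.
case: (pselect (exists a, A a /\ exists m, [/\ M m, m != 0 & lspan M s (a - m * y)])).
  move=> [a [Aa [m [Mm m0 sa]]]]; exists (a :: t); split.
    by move=> x; rewrite inE => /predU1P[->//|/At].
  move=> x Ax /= [n Mn sx]; have Mnm : M (n / m) by apply: MM => //; apply: MV.
  exists (n / m) => //; apply: st; first by apply: AB => //; apply: AZ.
  have -> : x - n / m * a = (x - n * y) - n / m * (a - m * y) by field.
  by apply: lspanB => //; apply: lspanZ.
move=> noA; exists t; split=> // x Ax /= [m Mm sx].
have [m0|m0] := eqVneq m 0; first by apply: st => //; rewrite m0 mul0r subr0 in sx.
by case: noA; exists x; split=> //; exists m.
Qed.

(* Extend [L] to a maximal [L]-subspace [V] missing [x]; then [K = V + L x]. *)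
Lemma exists_functional L s x : is_subfield L ->
  (forall y, lspan L s y) -> ~ L x ->
  exists T, [/\ End_over L T, T 1 = 0 & T x = 1].
Proof.
move=> sfL sK Lx; case: (sfL) => L0 L1 LB LM LV.
pose subsp V := [/\ V 0, (forall y z, V y -> V z -> V (y - z)) &
                (forall l y, L l -> V y -> V (l * y))].
have ext V : subsp V -> ~ V x -> exists V', [/\ subsp V', ~ V' x,
    forall y, V y -> V' y & forall y, y \in s -> exists2 l, L l & V' (y - l * x)].
  elim: s {sK} V => [|y s IHs] V sV Vx; first by exists V.
  case: (sV) => V0 VB VZ; pose V1 z := exists2 l, L l & V (z - l * y).
  (* Either [V + L y] contains [x], and then [y] already lies in [V + L x], or [V] can be enlarged
     by [y] and still miss [x]. *)
  have [[l Ll Vxly]|V1x] := pselect (V1 x).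
    have [V' [sV' V'x VV' V's]] := IHs _ sV Vx.
    exists V'; split=> // z; rewrite inE => /predU1P[->|]; last exact: V's.
    have l0 : l != 0.
      by apply: contra_notN Vx => /eqP l0; rewrite l0 mul0r subr0 in Vxly.
    exists l^-1; first exact: LV.
    have -> : y - l^-1 * x = - l^-1 * (x - l * y) by field.
    by apply: VV'; apply: VZ => //; apply: subfield_opp => //; apply: LV.
  have sV1 : subsp V1.
    split=> [|z t [m Lm Vz] [n Ln Vt]|m z Lm [n Ln Vz]].
    - by exists 0; rewrite // mul0r subr0.
    - exists (m - n); first exact: LB.
      have -> : z - t - (m - n) * y = (z - m * y) - (t - n * y) by ring.
      exact: VB.
    - exists (m * n); first exact: LM.
      by rewrite -mulrA -mulrBr; apply: VZ.
  have [V' [sV' V'x V1V' V's]] := IHs _ sV1 V1x.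
  exists V'; split=> // z.
    by move=> Vz; apply: V1V'; exists 0; rewrite // mul0r subr0.
  rewrite inE => /predU1P[->|]; last exact: V's.
  by exists 0; rewrite // mul0r subr0; apply: V1V'; exists 1; rewrite // mul1r subrr.
(* Starting from [L] itself puts [1] in [V], which gives [T 1 = 0] for the coefficient [T] of [x]
   modulo [V]. *)
have [||V [[V0 VB VZ] Vx LsubV Vs]] := ext L; [by split | by [] |].
have VD y z : V y -> V z -> V (y + z).
  by move=> Vy Vz; rewrite -[z]opprK -[- z]sub0r; apply/VB/VB.
have VK z : exists l, L l /\ V (z - l * x).
  move: z (sK z); apply: lspan_ind => [|y z [l [Ll Vy]] [m [Lm Vz]]|m y Lm /Vs[l Ll Vy]].
  - by exists 0; rewrite mul0r subr0.
  - exists (l + m); split; first exact: subfield_add.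
    by rewrite mulrDl opprD addrACA; apply: VD.
  - exists (m * l); split; first exact: LM.
    by rewrite -mulrA -mulrBr; apply: VZ.
have [T HT] := choice VK.
have Tuniq z l : L l -> V (z - l * x) -> T z = l.
  move=> Ll Vz; have [LT VT] := HT z; apply/eqP; rewrite -subr_eq0.
  apply: contra_notT Vx => lT; rewrite -[x](mulKf lT).
  apply: VZ; first exact/LV/LB.
  have -> : (T z - l) * x = (z - l * x) - (z - T z * x) by ring.
  exact: VB.
exists T; split.
- split=> [y z|l y Ll].
    have [[Ly Vy] [Lz Vz]] := (HT y, HT z).
    apply: Tuniq; first exact: subfield_add.
    by rewrite mulrDl opprD addrACA; apply: VD.
  have [Ly Vy] := HT y; apply: Tuniq; first exact: LM.
  by rewrite -mulrA -mulrBr; apply: VZ.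
- by apply: Tuniq => //; rewrite mul0r subr0; apply: LsubV.
- by apply: Tuniq; rewrite // mul1r subrr.
Qed.

(** For [x] outside [L], a functional with [T 1 = 0] and [T x = 1] does not commute with [x]. Thus a
    subfield is recovered from its endomorphism ring. *)
Lemma const_End_over L s : is_subfield L -> (forall y, lspan L s y) ->
  const (End_over L) = L.
Proof.
move=> sfL sK; apply/funext => x; apply/propext; split=> [cx|Lx T [_ TZ]]; last first.
  by apply/funext => y; apply: TZ.
apply: contrapT => /(exists_functional sfL sK)[T [LT T1 Tx]].
have /(congr1 (@^~ 1)) := cx T LT.
by rewrite mulr1 Tx T1 mulr0 => /eqP; rewrite oner_eq0.
Qed.

End Subfields.

(** * Differential operators and linear endomorphisms *)

Section DifferentialOperators.
Variable K : fieldType.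
Implicit Types (S L M : kset K) (D E T : K -> K).

Lemma diffF_End L n D : diffF L n D -> End_over L D.
Proof. by case: n => [->|n []] //; apply: End_over_zero. Qed.

Lemma Diff_End L D : Diff L D -> End_over L D.
Proof. by case=> n /diffF_End. Qed.

Lemma diffF_zero L n : diffF L n (@zero_op K).
Proof.
elim: n => //= n IHn; split=> [|f]; first exact: End_over_zero.
by rewrite commf0.
Qed.

Lemma diffF_subop L n D E :
  diffF L n D -> diffF L n E -> diffF L n (fun x => D x - E x).
Proof.
elim: n D E => [|n IHn] D E /= => [-> ->|[LD nD] [LE nE]].
  by apply/funext => x; rewrite /zero_op subrr.
split=> [|f]; first exact: End_over_subop.
have -> : commf (fun x => D x - E x) f = fun x => commf D f x - commf E f x.
  by apply/funext => x; rewrite /commf; ring.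
exact: IHn.
Qed.

Lemma diffF_lmul L n a D : diffF L n D -> diffF L n (fun x => a * D x).
Proof.
elim: n D => [|n IHn] D /= => [->|[LD nD]].
  by apply/funext => x; rewrite /zero_op mulr0.
split=> [|f]; first by apply: (@End_over_comp K L (mulop a)); first exact: End_over_mulop.
have -> : commf (fun x => a * D x) f = fun x => a * commf D f x.
  by apply/funext => x; rewrite /commf; ring.
exact: IHn.
Qed.

Lemma diffF_rmul L n a D : diffF L n D -> diffF L n (fun x => D (a * x)).
Proof.
elim: n D => [|n IHn] D /= => [->|[LD nD]]; first by [].
split=> [|f]; first by apply: (End_over_comp LD); apply: End_over_mulop.
have -> : commf (fun x => D (a * x)) f = fun x => commf D f (a * x).
  by apply/funext => x; rewrite /commf mulrCA.
exact: IHn.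
Qed.

Lemma diffFS L n D : diffF L n D -> diffF L n.+1 D.
Proof.
elim: n D => [|n IHn] D; first by move=> ->; apply: diffF_zero.
by move=> /= [LD nD]; split=> // f; apply: IHn.
Qed.

Lemma diffF_le L m n D : (m <= n)%N -> diffF L m D -> diffF L n D.
Proof.
by move=> /subnK <-; elim: (n - m)%N => // k IHk mD; rewrite addSn; apply/diffFS/IHk.
Qed.

Lemma Diff_sub L M D : (forall x, M x -> L x) -> Diff L D -> Diff M D.
Proof.
move=> sML [n nD]; exists n; elim: n D nD => //= n IHn D [LD nD].
by split=> [|f]; [apply: End_over_sub LD | apply: IHn].
Qed.

(** [ad] obeys a Leibniz rule in [f], so [commf T (f * g)] and [commf T f^-1] arise from [commf T f]
    and [commf T g] by multiplications on either side, which preserve the order. A bound on the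
    order therefore needs checking only on field generators. *)
Lemma subfield_commf_diffF L n T : is_subfield L -> End_over L T ->
  is_subfield (fun f => diffF L n (commf T f)) /\
  forall l, L l -> diffF L n (commf T l).
Proof.
move=> sfL LT.
have LTn l : L l -> diffF L n (commf T l).
  move=> Ll; have -> : commf T l = @zero_op K; last exact: diffF_zero.
  by case: LT => _ TZ; apply/funext => x; rewrite /commf TZ // subrr.
case: (sfL) => L0 L1 _ _ _; split=> //; split; [exact: LTn | exact: LTn | | |].
- move=> f g nf ng; suff -> : commf T (f - g) = fun x => commf T f x - commf T g x.
    exact: diffF_subop.
  by apply/funext => x; rewrite /commf mulrBl (End_overB _ _ LT); ring.
- move=> f g nf ng.
  suff -> : commf T (f * g) = fun x => commf T f (g * x) - - f * commf T g x.
    by apply: diffF_subop; [apply: diffF_rmul | apply: diffF_lmul].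
  by apply/funext => x; rewrite /commf mulrA; ring.
- move=> f nf; have [->|f0] := eqVneq f 0; first by rewrite invr0; apply: LTn.
  suff -> : commf T f^-1 = fun x => - f^-1 * commf T f (f^-1 * x).
    by apply: diffF_lmul; apply: diffF_rmul.
  by apply/funext => x; rewrite /commf mulVKf //; field.
Qed.

Lemma Diff_commf_gens L (s : seq K) T : is_subfield L ->
    (forall S, is_subfield S -> (forall a, L a -> S a) ->
       (forall x, x \in s -> S x) -> forall x, S x) ->
    End_over L T -> (forall x, x \in s -> Diff L (commf T x)) -> Diff L T.
Proof.
move=> sfL gen_s LT sT.
have [n nT] : exists n, forall x, x \in s -> diffF L n (commf T x).
  elim: s sT {gen_s} => [|x s IHs] sT; first by exists 0.
  have [|n nT] := IHs; first by move=> y ys; apply: sT; rewrite inE ys orbT.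
  have [|m mT] := sT x; first by rewrite mem_head.
  exists (maxn m n) => y; rewrite inE => /predU1P[->|/nT yT].
    exact: diffF_le (leq_maxl _ _) mT.
  exact: diffF_le (leq_maxr _ _) yT.
have [sfn Ln] := subfield_commf_diffF n sfL LT.
by exists n.+1; split=> //; apply: gen_s sfn Ln nT.
Qed.

(** Each [ad x] is nilpotent on [L]-linear operators because [x ^+ (p ^ n)] lies in [L]. The
    induction is on the sum of the nilpotency exponents [a x] over the generators: passing to
    [commf D x] lowers [a x] by one and, the [ad] commuting, keeps the others. *)
Lemma Diff_End_over L p n (s : seq K) T : p \in [pchar K] -> is_subfield L ->
    (forall x, L (x ^+ (p ^ n))) ->
    (forall S, is_subfield S -> (forall a, L a -> S a) ->
       (forall x, x \in s -> S x) -> forall x, S x) ->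
  End_over L T -> Diff L T.
Proof.
move=> pK sfL Lpn gen_s.
suff nilp N (a : K -> nat) D : (\sum_(x <- s) a x < N)%N ->
    (forall x, x \in s -> iter (a x) (fun U => commf U x) D = @zero_op K) ->
    End_over L D -> Diff L D.
  move=> LT; apply: (nilp _ (fun=> p ^ n)%N T) => // x _.
  rewrite commf_pexpn //; apply/funext => y; rewrite /commf.
  by case: LT => _ ->; rewrite ?subrr.
elim: N a D => // N IHN a D aN aD LD.
apply: (Diff_commf_gens sfL gen_s) => // x xs.
have [ax0|ax0] := posnP (a x).
  have -> : D = @zero_op K by have := aD x xs; rewrite ax0.
  by rewrite commf0; exists 0.
pose a' z := if z == x then (a x).-1 else a z.
apply: (IHN a'); last exact: End_over_commf.
  (* A generator may be listed several times; one occurrence of [x] gives the strict drop and the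
     other terms do not increase. *)
  rewrite -ltnS; apply: leq_trans aN; rewrite ltnS.
  rewrite !(big_rem x xs) /= {1}/a' eqxx -addSn prednK //.
  rewrite leq_add2l; apply: leq_sum => z _; rewrite /a'.
  by case: eqP => // ->; apply: leq_pred.
move=> z zs; rewrite /a'; case: eqP => [->|_].
  by rewrite -iterSr prednK // aD.
by rewrite iter_commfC aD // commf0.
Qed.

Lemma diffF_Kpow_linear L p n D : p \in [pchar K] ->
  diffF L n D -> End_over (Kpow p n) D.
Proof.
move=> pK nD; split=> [|_ x [f ->]]; first by case: (diffF_End nD).
have iter_commf m T : diffF L m T -> iter m (fun U => commf U f) T = @zero_op K.
  elim: m T => [//|m IHm T [_ mT]]; rewrite iterSr.
  by apply: IHm; apply: mT.
(* [diffF L n] consists of operators of order below [n], and [n < p ^ n]. *)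
have /iter_commf : diffF L (p ^ n) D.
  by apply: diffF_le nD; apply/ltnW/ltn_expl/prime_gt1/(pcharf_prime pK).
by rewrite commf_pexpn // => /(congr1 (@^~ x)) /eqP; rewrite subr_eq0 => /eqP.
Qed.

End DifferentialOperators.

(** * Dual families in spaces of operators *)

Section DualFamilies.
Variable K : fieldType.
Implicit Types (FF : kset (K -> K)) (D E : K -> K).

Definition op_subspace FF :=
  (forall D E, FF D -> FF E -> FF (fun x => D x - E x)) /\
  (forall a D, FF D -> FF (fun x => a * D x)).

Lemma op_subspace_sum FF (r : nat) (c : 'I_r -> K) (D : 'I_r -> K -> K) E :
  op_subspace FF -> FF E -> (forall i, FF (D i)) ->
  FF (fun x => E x - \sum_(i < r) c i * D i x).
Proof.
move=> [FB FZ] FE; elim: r c D => [|r IHr] c D FD.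
  by under eq_fun do rewrite big_ord0 subr0.
under eq_fun do rewrite big_ord_recr opprD addrA.
by apply: FB; [apply: IHr => i | apply: FZ].
Qed.

(* Gaussian elimination *)
Lemma dual_family FF (s : seq K) : op_subspace FF ->
  exists r (y : 'I_r -> K) (D : 'I_r -> K -> K),
  [/\ forall i, FF (D i), forall i j, D i (y j) = (i == j)%:R &
      forall E, FF E -> (forall i, E (y i) = 0) ->
        forall x, x \in s -> E x = 0].
Proof.
move=> [FB FZ]; elim: s => [|x s [r [y [D [FD Dy Ds]]]]].
  by exists 0, (fun=> 0), (fun _ _ => 0); split=> // -[].
have [[D1 [FD1 D1y D1x]]|noD] :=
    pselect (exists D1, [/\ FF D1, forall i, D1 (y i) = 0 & D1 x != 0]).
  pose En z := (D1 x)^-1 * D1 z.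
  have FEn : FF En by apply: FZ.
  have Enx : En x = 1 by rewrite /En mulVf.
  have Eny i : En (y i) = 0 by rewrite /En D1y mulr0.
  (* Index [ord_max] carries the new pair [x], [En]; each old [D j] is corrected by a multiple of
     [En] so as to vanish at [x]. *)
  exists r.+1, (fun i => oapp y x (unlift ord_max i)),
    (fun i => oapp (fun j z => D j z - D j x * En z) En (unlift ord_max i)).
  split=> [i|i j|E FE Ey].
  - by case: unliftP => [j _|_] //=; apply: FB => //; apply: FZ.
  - case: unliftP => [i' ->|->]; case: unliftP => [j' ->|->] /=.
    + by rewrite Dy Eny mulr0 subr0 (inj_eq lift_inj).
    + by rewrite Enx mulr1 subrr eq_sym (negPf (neq_lift _ _)).
    + by rewrite Eny (negPf (neq_lift _ _)).
    + by rewrite Enx eqxx.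
  - move=> z; rewrite inE => /predU1P[->|].
      by have := Ey ord_max; rewrite unlift_none.
    by move: z; apply: Ds => // i; have := Ey (lift ord_max i); rewrite liftK.
exists r, y, D; split=> // E FE Ey z; rewrite inE => /predU1P[->|]; last exact: Ds.
by apply: contrapT => /eqP Ex; apply: noD; exists E.
Qed.

End DualFamilies.

(** * The Jacobson-Bourbaki correspondence *)

Section Bourbaki.
Variable K : fieldType.
Implicit Types (S L M B : kset K) (F FF AA : kset (K -> K)) (D E T : K -> K).

(** When [s] determines the elements of [FF], the dual family spans: the difference of [E] and its
    expansion vanishes at every [y i], hence on [s], hence everywhere. *)
Lemma dual_basis FF (s : seq K) : op_subspace FF ->
    (forall E, FF E -> (forall x, x \in s -> E x = 0) -> forall x, E x = 0) ->
  exists r (y : 'I_r -> K) (D : 'I_r -> K -> K),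
  [/\ forall i, FF (D i), forall i j, D i (y j) = (i == j)%:R &
      forall E, FF E -> forall x, E x = \sum_(i < r) E (y i) * D i x].
Proof.
move=> sFF s_det; have [r [y [D [FD Dy Ds]]]] := dual_family s sFF.
exists r, y, D; split=> // E FE x; apply/eqP; rewrite -subr_eq0; apply/eqP.
have FE' := op_subspace_sum (fun i => E (y i)) sFF FE FD.
move: x; apply: (s_det _ FE') => x xs; apply: Ds FE' _ x xs => j.
rewrite (bigD1 j) //= Dy eqxx mulr1 big1 ?addr0 ?subrr // => i ij.
by rewrite Dy (negPf ij) mulr0.
Qed.

(* If [E] is in [AA], both [x |-> E (f * D i x)] and [x |-> E f * D i x] belong to
   [AA] and agree on the dual basis; hence [D i x] commutes with [AA]. *)
Lemma jacobson_bourbaki AA M (s : seq K) T :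
    (forall x, lspan M s x) -> (forall D, AA D -> End_over M D) ->
    (forall a, AA (mulop a)) ->
    (forall D E, AA D -> AA E -> AA (fun x => D x - E x)) ->
    (forall D E, AA D -> AA E -> AA (fun x => D (E x))) ->
  End_over (const AA) T -> AA T.
Proof.
move=> sK AM Amul AB AC LT.
have sAA : op_subspace AA by split=> // a D AD; apply: (AC (mulop a)).
have [|r [y [D [AD Dy expand]]]] := dual_basis (s := s) sAA.
  move=> E AE Es x; apply: (End_over_lspan_eq (AM _ AE) (End_over_zero M) Es).
  exact: sK.
have cD i x : const AA (D i x).
  move=> E AE; apply/funext => f.
  have AG : AA (fun z => E (f * D i z)).
    by apply: (AC E) => //; apply: (AC (mulop f)).
  rewrite mulrC (expand _ AG x) (bigD1 i) //= Dy eqxx mulr1 big1 ?addr0 1?mulrC // => j ji.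
  by rewrite Dy eq_sym (negPf ji) mulr0 (End_over0 (AM _ AE)) mul0r.
(* Expanding the identity [mulop 1] gives [x] as the sum of the [y i * D i x], and [T] is linear
   over the coefficients [D i x]. *)
have TE x : T x = \sum_(i < r) T (y i) * D i x.
  have := expand _ (Amul 1) x; rewrite {1}/mulop mul1r => {1}->.
  rewrite (End_over_sum _ _ LT); apply: eq_bigr => i _.
  by rewrite mulrC /mulop mul1r; case: LT => _ ->; rewrite // mulrC.
have Azero : AA (@zero_op K).
  have -> : @zero_op K = mulop 0 by apply/funext => x; rewrite /mulop mul0r.
  exact: Amul.
rewrite (_ : T = fun x => zero_op x - \sum_(i < r) - T (y i) * D i x).
  exact: op_subspace_sum.
apply/funext => x; rewrite /zero_op sub0r TE -sumrN.
by apply: eq_bigr => i _; rewrite mulNr opprK.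
Qed.

End Bourbaki.

(* Induct on [n] such that [d i ^ n] kills [v]: with the Euler operator
   [m i \o d i], both [d i v] and [v *+ n - m i (d i v)] are killed by
   [d i ^ n.-1]. *)
Lemma weyl_exhaustion (V : zmodType) (p r : nat) (P S : V -> Prop)
    (d m : 'I_r -> V -> V) :
    (forall v w, P v -> P w -> P (v - w)) ->
    (forall i v, P v -> P (d i v)) -> (forall i v, P v -> P (m i v)) ->
    (forall i v w, d i (v - w) = d i v - d i w) -> (forall i, m i 0 = 0) ->
    (forall i j v, P v -> d i (m j v) = m j (d i v) + v *+ (i == j)) ->
    (forall i j v, d i (d j v) = d j (d i v)) ->
    (forall i v, P v -> iter p (d i) v = 0) ->
    (forall v w, S v -> S w -> S (v + w)) -> (forall i v, S v -> S (m i v)) ->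
    (forall n v, (0 < n < p)%N -> S (v *+ n) -> S v) ->
    (forall v, P v -> (forall i, d i v = 0) -> S v) ->
  forall v, P v -> S v.
Proof.
move=> PB Pd Pm dB m0 dm dd dp SD Sm Sdiv S0.
have d0 i : d i 0 = 0 by have := dB i 0 0; rewrite !subrr.
have dN i v : d i (- v) = - d i v by rewrite -sub0r dB d0 sub0r.
have dD i v w : d i (v + w) = d i v + d i w by have := dB i v (- w); rewrite dN !opprK.
have dMn i n v : d i (v *+ n) = d i v *+ n.
  by elim: n => [|n IHn]; rewrite ?mulr0n // !mulrS dD IHn.
have PMn v n : P v -> P (v *+ n).
  move=> Pv; have P0 : P 0 by rewrite -(subrr v); apply: PB.
  elim: n => [|n IHn]; rewrite ?mulr0n // mulrSr -[X in _ + X]opprK -[- v]sub0r.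
  by apply/PB/PB.
have euler i n v : P v ->
    iter n (d i) (m i (d i v)) = m i (iter n.+1 (d i) v) + iter n (d i) v *+ n.
  move=> Pv; elim: n => [|n IHn]; first by rewrite mulr0n addr0.
  have Pn : P (iter n.+1 (d i) v) by elim: (n.+1) => //= k; apply: Pd.
  by rewrite [LHS]/= IHn dD dMn dm // eqxx -addrA -mulrS.
have iterB i n v w : iter n (d i) (v - w) = iter n (d i) v - iter n (d i) w.
  by elim: n => //= n ->.
have iterMn i n k v : iter n (d i) (v *+ k) = iter n (d i) v *+ k.
  by elim: n => //= n ->.
(* The first [j] operators already kill [v], and [k] remain. *)
suff step k j v : (j + k = r)%N -> P v -> (forall i : 'I_r, (i < j)%N -> d i v = 0) -> S v.
  by move=> v Pv; apply: (step r 0%N).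
elim: k j v => [|k IHk] j v.
  by rewrite addn0 => -> Pv dv; apply: S0 => // i; apply: dv.
move=> jk Pv dv; have jr : (j < r)%N by rewrite -jk addnS ltnS leq_addr.
pose i0 := Ordinal jr.
(* This bound is kept while the exponent [n] varies, so that [Sdiv] only ever divides by integers
   below [p]. *)
have : (p <= p)%N by [].
have := dp i0 v Pv; move: {-3}p => n; elim: n v Pv dv => [|n IHn] v Pv dv.
  by move=> /= -> _; apply: S0; rewrite -?(subrr v); [apply: PB | move=> i; rewrite subrr].
case: (posnP n) => [->|n_gt0] /= dnv ltnp.
  apply: (IHk j.+1) => // [|i]; first by rewrite addSnnS.
  by rewrite ltnS leq_eqVlt => /predU1P[ij|/dv//]; have -> : i = i0 by apply: val_inj.
apply: (Sdiv n); first by rewrite n_gt0.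
have Sdv : S (d i0 v).
  apply: IHn; rewrite -?iterSr //; [exact: Pd | | exact: ltnW].
  by move=> i ij; rewrite dd dv.
rewrite -(subrK (m i0 (d i0 v)) (v *+ n)); apply: SD; last exact: Sm.
apply: IHn; last exact: ltnW.
- by apply: PB; [apply: PMn | apply/Pm/Pd].
- move=> i ij; rewrite dB dMn dv // mul0rn dm; last exact: Pd.
  have /negbTE ni : i != i0 by rewrite -val_eqE /= neq_ltn ij.
  by rewrite dd dv // d0 m0 ni mulr0n addr0 subrr.
- by rewrite iterB iterMn euler //= dnv m0 add0r subrr.
Qed.

(** * Jacobson's correspondence in height one, on a whole field *)

Section HeightOne.
Variables (K : fieldType) (p : nat).
Hypothesis pK : p \in [pchar K].
Implicit Types (S L M A B : kset K) (F FF : kset (K -> K)) (D E T : K -> K).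

Let setT : kset K := fun=> True.

Lemma Der_1 A B D : A 1 -> Der A B D -> D 1 = 0.
Proof.
move=> A1 [_ _ _ DM _]; have := DM 1 1 A1 A1.
by rewrite !mul1r mulr1 => /eqP; rewrite addrC -subr_eq subrr eq_sym => /eqP.
Qed.

Lemma Der_const A B D b : A 1 -> B b -> Der A B D -> A b -> D b = 0.
Proof.
move=> A1 Bb AD Ab; rewrite -[b]mulr1; case: (AD) => _ _ _ _ DZ.
by rewrite DZ // (Der_1 A1 AD) mulr0.
Qed.

Lemma Der_End B D : Der setT B D -> End_over B D.
Proof. by case=> _ _ DD _ DZ; split=> [x y|b x Bb]; [apply: DD | apply: DZ]. Qed.

Lemma Der_op_subspace B : op_subspace (Der setT B).
Proof.
split=> [D E [_ _ DD DM DZ] [_ _ ED EM EZ]|a D [_ _ DD DM DZ]].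
  split=> [x /(_ I)[]|//|x y _ _|x y _ _|b x Bb _].
  - by rewrite DD // ED //; ring.
  - by rewrite DM // EM //; ring.
  - by rewrite DZ // EZ //; ring.
split=> [x /(_ I)[]|//|x y _ _|x y _ _|b x Bb _].
- by rewrite DD //; ring.
- by rewrite DM //; ring.
- by rewrite DZ //; ring.
Qed.

Lemma pchar_dvd_mulrn n (x : K) : (0 < n < p)%N -> x *+ n = 0 -> x = 0.
Proof.
move=> /andP[n_gt0 ltnp] /eqP; rewrite -mulr_natr mulf_eq0 => /orP[/eqP//|].
by rewrite -(dvdn_pcharf pK) gtnNdvd.
Qed.

Lemma pLie_op_subspace F : pLie p setT F -> op_subspace F.
Proof.
move=> [_ [_ FD FZ _ _]]; split=> [D E FD' FE|a D]; last exact: FZ.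
have -> : (fun x => D x - E x) = (fun x => D x + -1 * E x).
  by apply/funext => x; rewrite mulN1r.
by apply: FD => //; apply: FZ.
Qed.

(* With a dual basis [(y_i, D_i)] of [F], the [D_i] commute and satisfy
   [D_i ^ p = 0], because an element of [F] killing every [y_i] is zero. *)
Lemma pLie_closed F (s : seq K) E : pLie p setT F ->
    (forall x, lspan (powset setT p) s x) -> Der setT (Ann setT F) E -> F E.
Proof.
move=> FLie sK EF; have sF := pLie_op_subspace FLie.
case: (FLie) => FDer [F0 FD FZ FL Fp].
set M := powset setT p in sK FDer *.
have [|r [y [D [FDi Dy expand]]]] := dual_basis (s := s) sF.
  move=> D FDD Ds x; apply: (End_over_lspan_eq (Der_End (FDer _ FDD)) (End_over_zero M) Ds).
  exact: sK.
have F_eq0 G : F G -> (forall i, G (y i) = 0) -> forall x, G x = 0.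
  by move=> FG Gy x; rewrite (expand _ FG) big1 // => i _; rewrite Gy mul0r.
have D0 G : F G -> G 0 = 0 by move=> /FDer/Der_End; apply: End_over0.
have D1 G : F G -> G 1 = 0 by move=> /FDer; apply: Der_1.
have Ddelta G i j : F G -> G (D i (y j)) = 0.
  by move=> FG; rewrite Dy; case: (i == j); [apply: D1 | apply: D0].
have Ann_M x : M x -> Ann setT F x.
  by move=> Mx; split=> // G /FDer GD; apply: Der_const GD _.
(* Removing from [E] its expansion leaves a derivation that kills every [y i]; it remains to show
   that it is zero. *)
have E'der : Der setT M (fun x => E x - \sum_(i < r) E (y i) * D i x).
  apply: op_subspace_sum => [||i]; [exact: Der_op_subspace | | exact/FDer/FDi].
  by case: EF => EF0 EA ED EM EZ; split=> // b x /Ann_M; apply: EZ.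
set E' := (fun x => _) in E'der.
have E'0 x : E' x = 0.
  have E'y i : E' (y i) = 0.
    rewrite /E' (bigD1 i) //= Dy eqxx mulr1 big1 ?addr0 ?subrr // => j ji.
    by rewrite Dy (negPf ji) mulr0.
  case: (E'der) => _ _ E'D E'M _.
  (* The [D i] span [F], so their common kernel is [Ann setT F], where [E'] vanishes; and the zero
     set of [E'] is stable under multiplication by [y i] because [E' (y i) = 0]. *)
  apply: (@weyl_exhaustion K p r setT (fun v => E' v = 0) D (fun i v => y i * v)) => //.
  - by move=> i v w; apply: End_overB (Der_End (FDer _ (FDi i))).
  - by move=> i; rewrite mulr0.
  - move=> i j v _; case: (FDer _ (FDi i)) => _ _ _ -> // _.
    by rewrite Dy mulr_natl.
  - move=> i j v; apply/eqP; rewrite -subr_eq0; apply/eqP.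
    have FLij := FL _ _ (FDi i) (FDi j); move: v; apply: F_eq0 FLij _ => k.
    by rewrite !Ddelta // subrr.
  - move=> i v _; apply: (F_eq0 _ (Fp _ (FDi i))) => k.
    (* Two applications of [D i] already kill [y k], and [p] is at least 2. *)
    case: p (prime_gt1 (pcharf_prime pK)) => [|[|q]] // _; rewrite !iterSr Ddelta //.
    by elim: q => //= q ->; apply: D0.
  - by move=> v w Ev Ew; rewrite E'D // Ev Ew addr0.
  - by move=> i v Ev; rewrite E'M // Ev E'y mulr0 mul0r addr0.
  - move=> n v ltnp E'vn; apply: (pchar_dvd_mulrn ltnp); rewrite -E'vn.
    elim: n {ltnp E'vn} => [|n IHn].
      by rewrite !mulr0n; have := End_over0 (Der_End E'der).
    by rewrite !mulrS E'D // IHn.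
  - move=> v _ Dv; have Av : Ann setT F v.
      by split=> // G FG; rewrite (expand _ FG) big1 // => i _; rewrite Dv mulr0.
    rewrite /E' (Der_const _ Av EF) // big1 ?subrr // => i _.
    by rewrite Dv mulr0.
rewrite (_ : E = fun x => zero_op x - \sum_(i < r) - E (y i) * D i x).
  exact: op_subspace_sum.
apply/funext => x; have /eqP := E'0 x; rewrite subr_eq0 => /eqP ->.
rewrite /zero_op sub0r -sumrN.
by apply: eq_bigr => i _; rewrite mulNr opprK.
Qed.

Lemma lspan_generates M (s : seq K) : (forall x, lspan M s x) ->
  forall S, is_subfield S -> (forall a, M a -> S a) ->
    (forall x, x \in s -> S x) -> forall x, S x.
Proof.
move=> sK S sfS MS sS x; move: x (sK x); apply: lspan_ind => [|x y|m y Mm ys].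
- by case: sfS.
- exact: subfield_add.
- by case: sfS => _ _ _ SM _; apply: SM; [apply: MS | apply: sS].
Qed.

(* Subtracting [T 1] from an operator commuting with [y] leaves a derivation,
   by induction on the order, and derivations are determined on [y]. *)
Lemma diffF_centralizer B n r (y : 'I_r -> K) T :
    (forall D, Der setT B D -> (forall i, D (y i) = 0) -> forall x, D x = 0) ->
    diffF B n T -> (forall i x, commf T (y i) x = 0) ->
  forall x, T x = x * T 1.
Proof.
move=> y_det; elim: n T => [|n IHn] T /= => [-> *|[BT nT] Ty x].
  by rewrite /zero_op mulr0.
have IH f x' : commf T f x' = x' * commf T f 1.
  apply: IHn => // i z.
  rewrite commfC (_ : commf T (y i) = @zero_op K); last by apply/funext => t; apply: Ty.
  by rewrite commf0.
have TM f g : T (f * g) = f * T g + g * (T f - f * T 1).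
  by have /eqP := IH f g; rewrite /commf mulr1 subr_eq addrC => /eqP.
suff /(_ x)/eqP : forall x, T x - x * T 1 = 0 by rewrite subr_eq0 => /eqP.
apply: (y_det (fun x => T x - x * T 1)) => [|i].
  case: BT => TD TZ; split=> [a /(_ I)[]|//|a b _ _|a b _ _|b a Bb _].
  - by rewrite TD; ring.
  - by rewrite TM; ring.
  - by rewrite TZ //; ring.
by have := Ty i 1; rewrite /commf mulr1.
Qed.

(** For [z] outside [B] some [B]-linear [T] does not commute with [z]. Yet all of them commute with
    [z], by exhaustion: an operator commuting with every [y i] is a multiplication, and composing
    with [D i] on the right preserves commutation with [z] since [D i z = 0]. *)
Lemma Der_separates B (s : seq K) z : is_subfield B -> (forall x, B (x ^+ p)) ->
    (forall x, lspan B s x) -> (forall D, Der setT B D -> D z = 0) -> B z.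
Proof.
move=> sfB Bp sK Dz; apply: contrapT => Bz.
have [T [BT T1 Tz]] := exists_functional sfB sK Bz.
have [|r [y [D [BD Dy expand]]]] := dual_basis (s := s) (Der_op_subspace B).
  move=> D BD Ds x; apply: (End_over_lspan_eq (Der_End BD) (End_over_zero B) Ds).
  exact: sK.
suff : forall f, T (z * f) = z * T f.
  by move/(_ 1); rewrite mulr1 Tz T1 mulr0 => /eqP; rewrite oner_eq0.
have Dadd i := Der_End (BD i).
apply: (@weyl_exhaustion (K -> K) p r (End_over B)
  (fun U => forall f, U (z * f) = z * U f)
  (fun i U => commf U (y i)) (fun i U x => U (D i x))) => //.
- move=> U W BU BW; exact: End_over_subop.
- move=> i U; exact: End_over_commf.
- by move=> i U BU; apply: End_over_comp.
- by move=> i U W; apply/funext => x; rewrite /commf !addrfctE !opprfctE; ring.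
- move=> i j U BU; case: (BU) => UD _; apply/funext => x.
  rewrite addrfctE natmulfctE /commf.
  case: (BD j) => _ _ _ -> // _; rewrite UD Dy eq_sym.
  by case: eqP => _; rewrite ?mul1r ?mul0r ?mulr0n ?mulr1n ?(End_over0 BU); ring.
- by move=> i j U; rewrite commfC.
- move=> i U BU; rewrite commf_pexp //; apply/funext => x.
  by case: BU => _ UZ; rewrite /commf UZ ?subrr.
- by move=> U W Uz Wz f; rewrite !addrfctE Uz Wz mulrDr.
- move=> i U Uz f; case: (BD i) => _ _ _ -> // _.
  by rewrite (Dz _ (BD i)) mul0r addr0 Uz.
- move=> n U ltnp Uz f; apply/eqP; rewrite -subr_eq0; apply/eqP.
  apply: (pchar_dvd_mulrn ltnp); rewrite mulrnBl.
  by have := Uz f; rewrite !natmulfctE => ->; rewrite mulrnAr subrr.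
- move=> U BU Uy f.
  have [|n nU] := @Diff_End_over K B p 1 s U pK sfB _ (lspan_generates sK) BU.
    by move=> x; rewrite expn1.
  have U_mul : forall x, U x = x * U 1.
    apply: diffF_centralizer nU (fun i x => congr1 (@^~ x) (Uy i)) => D' BD' D'y x.
    by rewrite (expand _ BD') big1 // => i _; rewrite D'y mul0r.
  by rewrite U_mul [U f]U_mul mulrA.
Qed.

End HeightOne.

(** * Subfields as field types *)

Section SubfieldType.
Variables (K : fieldType) (A : kset K).

(** Carrying the proof [sfA] in the term lets the algebraic structures be inferred from the
    predicate. *)
Definition subfield_pred (sfA : is_subfield A) : {pred K} := fun x => `[<A x>].

Variable sfA : is_subfield A.

Lemma subfield_pred_closed : GRing.divring_closed (subfield_pred sfA).
Proof.
case: (sfA) => A0 A1 AB AM AV; split; rewrite /subfield_pred ?unfold_in.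
- exact/asboolP.
- by move=> x y /asboolP Ax /asboolP Ay; apply/asboolP/AB.
- by move=> x y /asboolP Ax /asboolP Ay; apply/asboolP/AM => //; apply/AV.
Qed.

HB.instance Definition _ :=
  GRing.isDivringClosed.Build K (subfield_pred sfA) subfield_pred_closed.

Definition subfield_type := {x : K | x \in subfield_pred sfA}.

HB.instance Definition _ := SubChoice.on subfield_type.
HB.instance Definition _ := [SubChoice_isSubIntegralDomain of subfield_type by <:].
HB.instance Definition _ := [SubIntegralDomain_isSubField of subfield_type by <:].

Lemma subfield_valP (a : subfield_type) : A (val a).
Proof. exact/asboolP/(valP a). Qed.

Lemma subfield_typeP x : A x -> exists a : subfield_type, val a = x.
Proof. by move=> /asboolT Ax; exists (exist _ x Ax). Qed.

Lemma subfield_restrict (D : K -> K) : (forall x, A x -> A (D x)) ->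
  exists d : subfield_type -> subfield_type, forall a, val (d a) = D (val a).
Proof.
move=> AD; have [d dE] := choice (fun a => subfield_typeP (AD _ (subfield_valP a))).
by exists d.
Qed.

Lemma subfield_map_val (t : seq K) : (forall x, x \in t -> A x) ->
  exists u : seq subfield_type, t = map val u.
Proof.
elim: t => [|x t IHt] At; first by exists [::].
have [|u ->] := IHt; first by move=> y yt; apply: At; rewrite inE yt orbT.
have [a <-] := subfield_typeP (At x (mem_head _ _)).
by exists (a :: u).
Qed.

Lemma lspan_val (M : kset K) (B : kset subfield_type) (t : seq subfield_type) :
  (forall m, M m -> exists2 b, B b & val b = m) ->
  forall a, lspan M (map val t) (val a) -> lspan B t a.
Proof.
move=> MB; elim: t => [|b t IHt] a /=; first by move=> a0; apply: val_inj.
move=> [_ /MB[c Bc <-] at_]; exists c => //; apply: IHt.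
by rewrite rmorphB rmorphM.
Qed.

(** Extension by zero, matching the encoding of derivations in [Der]. *)
Definition extend0 (d : subfield_type -> subfield_type) (x : K) : K :=
  oapp (fun a => val (d a)) 0 (insub x).

Lemma extend0_val d a : extend0 d (val a) = val (d a).
Proof. by rewrite /extend0 valK. Qed.

Lemma extend0_out d x : ~ A x -> extend0 d x = 0.
Proof.
move=> Ax; rewrite /extend0 insubN //.
by apply: contra_notN Ax => /asboolP.
Qed.

End SubfieldType.

(** * Height one over an arbitrary subfield, by transport to its field type *)

Section HeightOneSubfields.
Variables (K : fieldType) (p : nat).
Hypothesis pK : p \in [pchar K].
Implicit Types (S L M A B : kset K) (F FF : kset (K -> K)) (D E T : K -> K).

Lemma Der_separates_subfield A B (t : seq K) z : is_subfield A -> is_subfield B ->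
    (forall x, B x -> A x) -> (forall x, A x -> B (x ^+ p)) ->
    (forall x, x \in t -> A x) -> (forall x, A x -> lspan B t x) ->
    A z -> ~ B z -> exists2 D, Der A B D & D z <> 0.
Proof.
move=> sfA sfB BA Bp At sA Az Bz; apply: contrapT => noD; apply: Bz.
have [u tu] := subfield_map_val sfA At; have [a az] := subfield_typeP sfA Az.
set AT := subfield_type sfA in u tu a az.
have pAT : p \in [pchar AT] by rewrite -(fmorph_pchar (val : {rmorphism AT -> K})).
pose B' : kset AT := fun b => B (val b).
rewrite -az; apply: (@Der_separates _ p pAT B' u a).
- case: sfB => B0 B1 BB BM BV; split; rewrite /B' ?rmorph0 ?rmorph1 //.
  + by move=> x y; rewrite rmorphB; apply: BB.
  + by move=> x y; rewrite rmorphM; apply: BM.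
  + by move=> x; rewrite fmorphV; apply: BV.
- by move=> x; rewrite /B' rmorphXn; apply: Bp; apply: subfield_valP.
- move=> x; apply: (@lspan_val _ _ sfA B) => [m Bm|].
    by have [b bm] := subfield_typeP sfA (BA _ Bm); exists b; rewrite // /B' bm.
  by rewrite -tu; apply: sA; apply: subfield_valP.
move=> d [_ _ dD dM dZ]; apply: val_inj; rewrite -[LHS]extend0_val az rmorph0.
apply: contrapT => dz; apply: noD; exists (extend0 d) => //.
have liftP x := @subfield_typeP K A sfA x.
split=> [x|x|x y|x y|b x Bb].
- exact: extend0_out.
- by move=> /liftP[c <-]; rewrite extend0_val; apply: subfield_valP.
- move=> /liftP[c <-] /liftP[c' <-].
  by rewrite -rmorphD !extend0_val dD // rmorphD.
- move=> /liftP[c <-] /liftP[c' <-].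
  by rewrite -rmorphM !extend0_val dM // rmorphD !rmorphM.
- move=> /liftP[c <-]; have /liftP[b' b'b] := BA _ Bb.
  by rewrite -b'b -rmorphM !extend0_val dZ ?rmorphM // /B' b'b.
Qed.

Lemma pLie_closed_subfield A F (t : seq K) : is_subfield A -> pLie p A F ->
    (forall x, x \in t -> A x) -> (forall x, A x -> lspan (powset A p) t x) ->
  Der A (Ann A F) = F.
Proof.
move=> sfA [FDer [F0 FD FZ FL Fp]] At sA.
have powA m : powset A p m -> A m by move=> [y [Ay ->]]; apply: subfield_exp.
apply/funext => E; apply/propext; split=> [EF|FE]; last first.
  have [E0 EA ED EM _] := FDer _ FE; split=> // b x [Ab Fb] Ax.
  by rewrite EM // (Fb _ FE) mul0r addr0.
have [u tu] := subfield_map_val sfA At.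
set AT := subfield_type sfA in u tu.
have pAT : p \in [pchar AT] by rewrite -(fmorph_pchar (val : {rmorphism AT -> K})).
have AP := @subfield_valP K A sfA.
(* The restrictions to [A] of the members of [F]. *)
pose F' : kset (AT -> AT) := fun d => exists2 D, F D & forall a, val (d a) = D (val a).
have [E0 EA ED EM EZ] := EF.
have [e eE] := subfield_restrict sfA EA.
have [|||D FDD eD] // := @pLie_closed AT p pAT F' u e.
- split.
    move=> d [D /FDer[D0 DA DD DM DZ] dD].
    split=> [x /(_ I)[]|//|x y _ _|x y _ _|b x [y [_ ->]] _];
      apply: val_inj; rewrite !(rmorphD, rmorphM, rmorphXn, dD) /= ?[sval (d _)]dD.
    + by apply: DD; apply: AP.
    + by apply: DM; apply: AP.
    + by apply: DZ; [exists (val y); split=> //; apply: AP | apply: AP].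
  split.
  + by exists (@zero_op K) => // a; rewrite /zero_op rmorph0.
  + move=> d d' [D FDD dD] [D' FD' dD']; exists (fun x => D x + D' x); first exact: FD.
    by move=> a; rewrite rmorphD /= [sval (d a)]dD [sval (d' a)]dD'.
  + move=> a d _ [D FDD dD]; exists (fun x => val a * D x); first exact: FZ.
    by move=> b; rewrite rmorphM /= [sval (d b)]dD.
  + move=> d d' [D FDD dD] [D' FD' dD']; exists (fun x => D (D' x) - D' (D x)).
      exact: FL.
    move=> a; rewrite rmorphB /= [sval (d (d' a))]dD dD'.
    by rewrite [sval (d' (d a))]dD' dD.
  + move=> d [D FDD dD]; exists (iter p D); first exact: Fp.
    by move=> a; elim: p => //= n <-; apply: dD.
- move=> x; apply: (@lspan_val _ _ sfA (powset A p)) => [m [y [Ay ->]]|].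
    have [b <-] := subfield_typeP sfA Ay; exists (b ^+ p); last by rewrite rmorphXn.
    by exists b.
  by rewrite -tu; apply: sA.
- split=> [x /(_ I)[]|//|x y _ _|x y _ _|b x [_ bF] _];
      apply: val_inj; rewrite !(rmorphD, rmorphM, eE) /= ?[sval (e _)]eE.
  + by apply: ED; apply: AP.
  + by apply: EM; apply: AP.
  + apply: EZ; last exact: AP.
    split=> [|D FDD]; first exact: AP.
    have [_ DA _ _ _] := FDer _ FDD; have [d dD] := subfield_restrict sfA DA.
    rewrite -dD (bF d) ?rmorph0 //; by exists D.
suff -> : E = D by [].
apply/funext => x; have [Ax|nAx] := pselect (A x).
  by have [a <-] := subfield_typeP sfA Ax; rewrite -eE eD.
by rewrite E0 //; case: (FDer _ FDD) => ->.
Qed.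

End HeightOneSubfields.

(** * Composites, Frobenius, constants and annihilators *)

Section Composites.
Variables (K : fieldType) (p : nat).
Hypothesis pK : p \in [pchar K].
Implicit Types (S L M A B : kset K) (F FF : kset (K -> K)) (D E T : K -> K).

Lemma composite_subfield A B : is_subfield (composite A B).
Proof.
split=> [S [] //|S [] //|x y Ax Ay S sfS AS BS|x y Ax Ay S sfS AS BS|x Ax S sfS AS BS];
  case: (sfS) => S0 S1 SB SM SV.
- by apply: SB; [apply: Ax | apply: Ay].
- by apply: SM; [apply: Ax | apply: Ay].
- by apply: SV; apply: Ax.
Qed.

Lemma compositel A B x : A x -> composite A B x.
Proof. by move=> Ax S _ AS _; apply: AS. Qed.

Lemma compositer A B x : B x -> composite A B x.
Proof. by move=> Bx S _ _ BS; apply: BS. Qed.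

(** Frobenius is a ring morphism. This allows statements on [p]-th powers of elements of a composite
    to be checked on the two factors. *)
Lemma subfield_preim_exp S : is_subfield S -> is_subfield (fun x => S (x ^+ p)).
Proof.
have p_gt0 := prime_gt0 (pcharf_prime pK).
case=> S0 S1 SB SM SV; split=> [||x y|x y|x].
- by rewrite expr0n gtn_eqF.
- by rewrite expr1n.
- by rewrite -!(pFrobenius_autE pK) rmorphB; apply: SB.
- by rewrite exprMn; apply: SM.
- by rewrite exprVn; apply: SV.
Qed.

Lemma Kpow_subfield n : is_subfield (Kpow (K := K) p n).
Proof.
have pn_gt0 : (0 < p ^ n)%N by rewrite expn_gt0 prime_gt0 // (pcharf_prime pK).
split=> [||_ _ [x ->] [y ->]|_ _ [x ->] [y ->]|_ [x ->]].
- by exists 0; rewrite expr0n gtn_eqF.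
- by exists 1; rewrite expr1n.
- exists (x - y); elim: n {pn_gt0} => [|n IHn]; first by rewrite !expr1.
  by rewrite expnSr !exprM -IHn -!(pFrobenius_autE pK) rmorphB.
- by exists (x * y); rewrite exprMn.
- by exists x^-1; rewrite exprVn.
Qed.

Lemma Kpow_exp n (x : K) : Kpow p n (x ^+ (p ^ n)).
Proof. by exists x. Qed.

Lemma Kpow_le m n (x : K) : (m <= n)%N -> Kpow p n x -> Kpow p m x.
Proof.
by move=> /subnK <- [y ->]; exists (y ^+ (p ^ (n - m))); rewrite -exprM -expnD.
Qed.

Lemma KpowS n A (x : K) : (forall y, Kpow p n y -> A y) ->
  Kpow p n.+1 x -> powset A p x.
Proof.
move=> KA [y ->]; exists (y ^+ (p ^ n)); split; first exact/KA/Kpow_exp.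
by rewrite expnSr exprM.
Qed.

Lemma constP FF x : const FF x <-> forall D, FF D -> forall y, D (x * y) = x * D y.
Proof.
split=> Fx D FD; last by apply/funext => y; apply: Fx.
by move=> y; apply: (congr1 (@^~ y) (Fx D FD)).
Qed.

(** Used to pass from linearity over two subfields to linearity over their composite. *)
Lemma subfield_linear_locus L D : is_subfield L -> End_over L D ->
  is_subfield (fun x => forall y, D (x * y) = x * D y).
Proof.
case=> L0 L1 _ _ _ LD; have [DA DZ] := LD; split=> [||x y xD yD z|x y xD yD z|x xD z].
- by move=> y; apply: DZ.
- by move=> y; apply: DZ.
- by rewrite !mulrBl (End_overB _ _ LD) xD yD.
- by rewrite -!mulrA xD yD.
- have [->|x0] := eqVneq x 0; first by rewrite invr0; apply: DZ.
  by apply: (mulfI x0); rewrite -xD !mulVKf.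
Qed.

Lemma const_subfield L FF : is_subfield L -> (forall D, FF D -> End_over L D) ->
  is_subfield (const FF).
Proof.
move=> sfL FL; have sfD D FD := subfield_linear_locus sfL (FL D FD).
split=> [||x y|x y|x]; rewrite ?constP.
- by move=> D /sfD[].
- by move=> D /sfD[].
- by move=> xF yF D FD; have [_ _ SB _ _] := sfD D FD; apply: SB; auto.
- by move=> xF yF D FD; have [_ _ _ SM _] := sfD D FD; apply: SM; auto.
- by move=> xF D FD; have [_ _ _ _ SV] := sfD D FD; apply: SV; auto.
Qed.

Lemma Der_kernel A B D : is_subfield A -> Der A B D ->
  is_subfield (fun x => A x /\ D x = 0).
Proof.
case=> A0 A1 AB AM AV BD; have [_ _ DD DM _] := BD.
have D0 : D 0 = 0 by have := DM 0 0 A0 A0; rewrite !mul0r mulr0 addr0.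
split=> [||x y [Ax Dx] [Ay Dy]|x y [Ax Dx] [Ay Dy]|x [Ax Dx]]; split; auto.
- exact: Der_1 BD.
- by have := DD _ _ (AB _ _ Ax Ay) Ay; rewrite subrK Dx Dy addr0.
- by rewrite DM // Dx Dy mul0r mulr0 addr0.
- have [->|x0] := eqVneq x 0; first by rewrite invr0.
  have := DM _ _ Ax (AV _ Ax); rewrite mulfV // (Der_1 A1 BD) Dx mul0r addr0.
  by move/esym/eqP; rewrite mulf_eq0 (negPf x0) => /eqP.
Qed.

Lemma Ann_subfield A F : is_subfield A -> pLie p A F ->
  is_subfield (Ann A F) /\ forall x, A x -> Ann A F (x ^+ p).
Proof.
move=> sfA [FDer _]; have [A0 A1 AB AM AV] := sfA; split.
  have ker D FD := Der_kernel sfA (FDer D FD).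
  split=> [||x y [Ax Fx] [Ay Fy]|x y [Ax Fx] [Ay Fy]|x [Ax Fx]]; split; auto.
  - by move=> D /ker[[]].
  - by move=> D /ker[_ []].
  - by move=> D FD; have [_ _ SB _ _] := ker D FD; case: (SB x y); auto.
  - by move=> D FD; have [_ _ _ SM _] := ker D FD; case: (SM x y); auto.
  - by move=> D FD; have [_ _ _ _ SV] := ker D FD; case: (SV x); auto.
move=> x Ax; have Axp := subfield_exp p sfA Ax; split=> // D /FDer DD.
by apply: (Der_const A1 _ DD Axp); exists x.
Qed.

Lemma Der_pLie A B : is_subfield A -> is_subfield B ->
  (forall x, A x -> B (x ^+ p)) -> pLie p A (Der A B).
Proof.
move=> sfA sfB Bp; have [A0 A1 AB AM AV] := sfA.
have AD x y : A x -> A y -> A (x + y) by apply: subfield_add.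
split=> [D [D0 DA DD DM DZ]|].
  by split=> // _ x [y [Ay ->]]; apply: DZ; apply: Bp.
split.
- by split=> [||x y|x y|b x]; rewrite /zero_op ?addr0 ?mulr0 ?mul0r ?addr0.
- move=> D E [D0 DA DD DM DZ] [E0 EA ED EM EZ].
  split=> [x Ax|x Ax|x y Ax Ay|x y Ax Ay|b x Bb Ax]; auto.
  + by rewrite D0 ?E0 ?addr0.
  + by rewrite DD ?ED //; ring.
  + by rewrite DM ?EM //; ring.
  + by rewrite DZ ?EZ //; ring.
- move=> a D Aa [D0 DA DD DM DZ].
  split=> [x Ax|x Ax|x y Ax Ay|x y Ax Ay|b x Bb Ax]; auto.
  + by rewrite D0 ?mulr0.
  + by rewrite DD //; ring.
  + by rewrite DM //; ring.
  + by rewrite DZ //; ring.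
- move=> D E DDer EDer; have [D0 DA DD DM DZ] := DDer; have [E0 EA ED EM EZ] := EDer.
  have Dz : D 0 = 0 by have [[]] := Der_kernel sfA DDer.
  have Ez : E 0 = 0 by have [[]] := Der_kernel sfA EDer.
  split=> [x Ax|x Ax|x y Ax Ay|x y Ax Ay|b x Bb Ax]; auto.
  + by rewrite (D0 x) // (E0 x) // Dz Ez subrr.
  + by rewrite (ED x y) // (DD x y) // DD ?ED; auto; ring.
  + by rewrite (EM x y) // (DM x y) // DD ?ED ?DM ?EM; auto; ring.
  + by rewrite (DZ b x) // (EZ b x) // DZ ?EZ; auto; ring.
- move=> D DDer; have [D0 DA DD DM DZ] := DDer.
  have Dz : D 0 = 0 by have [[]] := Der_kernel sfA DDer.
  have p_gt0 := prime_gt0 (pcharf_prime pK).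
  have itA n x : A x -> A (iter n D x) by move=> Ax; elim: n => //= n; apply: DA.
  have itD n x y : A x -> A y -> iter n D (x + y) = iter n D x + iter n D y.
    by move=> Ax Ay; elim: n => //= n ->; rewrite DD //; apply: itA.
  split=> [x nAx|x|x y|x y Ax Ay|b x Bb Ax]; [|exact: itA|exact: itD| |].
  + case: p p_gt0 => // q _; rewrite iterSr D0 //.
    by elim: q => //= q ->.
  (* Leibniz for the [p]-th iterate: [i] and [j] count the derivatives that have fallen on [x] and
     on [y]. *)
  + pose S n i j := iter n D (iter i D x * iter j D y).
    have recS n i j : S n.+1 i j = S n i.+1 j + S n i j.+1.
      have [Ax' Ay'] := (itA i x Ax, itA j y Ay).
      have [ADx ADy] := (DA _ Ax', DA _ Ay').
      rewrite /S iterSr DM // [RHS]addrC.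
      by apply: itD; apply: AM.
    by have := pascal_pchar pK recS 0 0; rewrite /S /= !add0n addrC.
  + by elim: p => //= n ->; rewrite DZ //; apply: itA.
Qed.

End Composites.

(** * Finiteness over the fields of [p ^ n]-th powers *)

Section FinitelyGenerated.
Variables (K : fieldType) (p : nat).
Hypothesis pK : p \in [pchar K].
Hypothesis fgK : fin_gen_over (perfection (K := K) p).
Implicit Types (S L M A B : kset K) (F FF : kset (K -> K)) (D E T : K -> K).

(** Generators over the perfection also generate over the larger field [Kpow p n], which contains
    all [p ^ n]-th powers. *)
Lemma lspan_Kpow n : exists t, forall x : K, lspan (Kpow p n) t x.
Proof.
have [s gen_s] := fgK.
have pn_gt0 : (0 < p ^ n)%N by rewrite expn_gt0 prime_gt0 // (pcharf_prime pK).
apply: (finite_lspan (Kpow_subfield pK n) pn_gt0 (s := s)) => [x|S sfS KS sS].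
  exact: Kpow_exp.
by apply: gen_s => // a a_perf; apply/KS/a_perf.
Qed.

(** [A] is a subspace of the finite-dimensional [K] over [Kpow p n.+1], and these scalars lie in
    [powset A p]. *)
Lemma lspan_Kpow_subfield n A : is_subfield A -> (forall x, Kpow p n x -> A x) ->
  exists t, (forall x, x \in t -> A x) /\ forall x, A x -> lspan (powset A p) t x.
Proof.
move=> sfA KA; have [s sK] := lspan_Kpow n.+1; have [_ _ AB AM _] := sfA.
have [|t [At tA]] := subspace_lspan s (Kpow_subfield pK n.+1) AB.
  by move=> m x /(Kpow_le (leqnSn n))/KA; apply: AM.
exists t; split=> // x Ax; have := tA x Ax (sK x).
by apply: lspan_mono => y; apply: KpowS.
Qed.

Lemma Diff_End_overE n L D : is_subfield L -> (forall x, Kpow p n x -> L x) ->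
  Diff L D <-> End_over L D.
Proof.
move=> sfL KL; split=> [|LD]; first exact: Diff_End.
have [s gen_s] := fgK.
apply: (Diff_End_over (s := s) pK sfL (n := n)) => // [x|S sfS LS sS].
  exact/KL/Kpow_exp.
by apply: gen_s => // a a_perf; apply/LS/KL/a_perf.
Qed.

Lemma Der_separates_Kpow n A B z : is_subfield A -> is_subfield B ->
    (forall x, Kpow p n x -> A x) -> (forall x, B x -> A x) ->
    (forall x, A x -> B (x ^+ p)) -> A z -> ~ B z ->
  exists2 D, Der A B D & D z <> 0.
Proof.
move=> sfA sfB KA BA Bp; have [t [At tA]] := lspan_Kpow_subfield sfA KA.
apply: (Der_separates_subfield pK sfA sfB BA Bp At) => x /tA.
by apply: lspan_mono => _ [y [Ay ->]]; apply: Bp.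
Qed.

(** * From power towers to Jacobson sequences and algebras *)

Section Tower.
Variable W : nat -> kset K.
Hypothesis tW : power_tower p W.

Lemma tower_subfield i : is_subfield (W i).
Proof. by case: tW. Qed.

Lemma tower_composite i j : (j <= i)%N -> W j = composite (W i) (Kpow p j).
Proof. by case: tW => _; apply. Qed.

Lemma Kpow_tower i x : Kpow p i x -> W i x.
Proof. by rewrite (tower_composite (leqnn i)); apply: compositer. Qed.

Lemma tower_le i j x : (j <= i)%N -> W i x -> W j x.
Proof. by move=> /tower_composite ->; apply: compositel. Qed.

Lemma tower0 : W 0 = fun=> True.
Proof.
by apply/funext => x; apply/propext; split=> // _; apply: Kpow_tower; exists x.
Qed.

(** [W i] is generated by [W i.+1] and [Kpow p i], and Frobenius sends both into [W i.+1]. *)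
Lemma tower_exp i x : W i x -> W i.+1 (x ^+ p).
Proof.
rewrite {1}(tower_composite (leqnSn i)) => /(_ (fun x => W i.+1 (x ^+ p))).
apply; first exact: (subfield_preim_exp pK (tower_subfield _)).
  by move=> a; apply: subfield_exp; apply: tower_subfield.
by move=> _ [y ->]; apply: Kpow_tower; exists y; rewrite -exprM -expnSr.
Qed.

Lemma tower_AnnSeq i : AnnSeq (fun j => Der (W j) (W j.+1)) i = W i.
Proof.
elim: i => [|i /= ->]; first by rewrite tower0.
have [sfi sfi1] := (tower_subfield i, tower_subfield i.+1).
apply/funext => x; apply/propext; split=> [[Wx Dx]|Wx].
  apply: contrapT => nWx.
  have [D DD] := Der_separates_Kpow sfi sfi1 (@Kpow_tower i)
    (fun y => @tower_le i.+1 i y (leqnSn i)) (@tower_exp i) Wx nWx.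
  by apply; apply: Dx.
have Wix := tower_le (leqnSn i) Wx; split=> // D DD.
by apply: (Der_const _ Wx DD Wix); case: sfi.
Qed.

(** A derivation in the forbidden intersection at level [m.+1] kills [W m.+2] and also
    [Kpow p m.+1], which consists of [p]-th powers from [W m]. These two generate [W m.+1], so it is
    zero. *)
Lemma tower_jacobson : jacobson_seq p (fun i => Der (W i) (W i.+1)).
Proof.
have pLieW i : pLie p (W i) (Der (W i) (W i.+1)).
  by apply: Der_pLie => //; [apply: tower_subfield.. | apply: tower_exp].
split=> [|[//|m] _]; rewrite !tower_AnnSeq; first exact: pLieW.
split; first exact: pLieW.
apply/funext => D; apply/propext; split=> [[DD DD']|->]; last first.
  split; first by case: (pLieW m.+1) => _ [].
  split=> [||x y|x y|b x]; rewrite /zero_op ?addr0 ?mulr0 ?mul0r ?addr0 //.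
  by move=> *; case: (tower_subfield m.+1).
have sf := tower_subfield m.+1; have [W0 W1 _ _ _] := sf.
apply/funext => x; have [Wx|nWx] := pselect (W m.+1 x); last by case: DD => ->.
suff [] : W m.+1 x /\ D x = 0 by [].
have := Wx; rewrite {1}(tower_composite (leqnSn m.+1)).
move/(_ (fun x => W m.+1 x /\ D x = 0)); apply.
- exact: Der_kernel DD.
- move=> a Wa; have Wa' := tower_le (leqnSn m.+1) Wa; split=> //.
  exact: Der_const DD Wa'.
- move=> b Kb; have Wb := Kpow_tower Kb; split=> //.
  apply: (Der_const W1 _ DD' Wb) => /=.
  by apply: KpowS Kb; apply: Kpow_tower.
Qed.

Lemma tower_to_algP D : tower_to_alg W D <-> exists i, End_over (W i) D.
Proof.
split=> -[i]; exists i; first exact: Diff_End.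
by apply/(Diff_End_overE _ (tower_subfield i) (@Kpow_tower i)).
Qed.

Lemma tower_K_subalg : K_subalg_Diff (perfection p) (tower_to_alg W).
Proof.
have EndW i j D : (i <= j)%N -> End_over (W i) D -> End_over (W j) D.
  by move=> ij; apply: End_over_sub => x; apply: tower_le.
split.
- move=> D [i]; apply: Diff_sub => x; move/(_ i); exact: Kpow_tower.
- by move=> a; apply/tower_to_algP; exists 0; apply: End_over_mulop.
- move=> D E /tower_to_algP[i Di] /tower_to_algP[j Ej].
  apply/tower_to_algP; exists (maxn i j).
  by apply: End_over_subop; [apply: EndW Di | apply: EndW Ej]; rewrite (leq_maxl, leq_maxr).
- move=> D E /tower_to_algP[i Di] /tower_to_algP[j Ej].
  apply/tower_to_algP; exists (maxn i j).
  by apply: End_over_comp; [apply: EndW Di | apply: EndW Ej]; rewrite (leq_maxl, leq_maxr).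
Qed.

(** An operator linear over [W i] and [Kpow p n] is linear over [W n]: for [n <= i] because [W n] is
    the composite of the two, otherwise because [W n] lies in [W i]. *)
Lemma tower_const n : const (DD_n p (tower_to_alg W) n) = W n.
Proof.
apply/funext => x; apply/propext; split=> [cx|Wx].
  have [s sK] := lspan_Kpow n.
  rewrite -(const_End_over (tower_subfield n) (s := s)); last first.
    by move=> y; apply: lspan_mono (sK y); apply: Kpow_tower.
  move=> D /(Diff_End_overE _ (tower_subfield n) (@Kpow_tower n)) DW.
  apply: cx; split; first by exists n.
  by apply: Diff_sub DW; apply: Kpow_tower.
apply/constP => D [/tower_to_algP[i Di] /Diff_End KD].
have [ni|/ltnW/tower_le ni] := leqP n i; last first.
  by move=> y; case: Di => _ -> //; apply: ni.
have := Wx; rewrite {1}(tower_composite ni).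
move/(_ (fun x => forall y, D (x * y) = x * D y)); apply.
- exact: (subfield_linear_locus (tower_subfield i) Di).
- by move=> a Wa y; case: Di => _ ->.
- by move=> b Kb y; case: KD => _ ->.
Qed.

End Tower.

(** * From Jacobson sequences to power towers *)

Section Jacobson.
Variable F : nat -> kset (K -> K).
Hypothesis jF : jacobson_seq p F.
Let W := AnnSeq F.

Lemma jacobson_pLie i : pLie p (W i) (F i).
Proof. by case: jF => F0 FS; case: i => // i; case: (FS i.+1). Qed.

Lemma AnnSeq_subfield i : is_subfield (W i).
Proof.
elim: i => // i IHi; exact: (Ann_subfield IHi (jacobson_pLie i)).1.
Qed.

Lemma AnnSeq_exp i x : W i x -> W i.+1 (x ^+ p).
Proof. exact: (Ann_subfield (AnnSeq_subfield i) (jacobson_pLie i)).2. Qed.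

Lemma AnnSeqS i x : W i.+1 x -> W i x.
Proof. by case. Qed.

Lemma Kpow_AnnSeq i x : Kpow p i x -> W i x.
Proof.
elim: i x => // i IHi _ [y ->]; rewrite expnSr exprM.
exact/AnnSeq_exp/IHi/Kpow_exp.
Qed.

Lemma Der_AnnSeq i : Der (W i) (W i.+1) = F i.
Proof.
have sf := AnnSeq_subfield i.
have [t [At tA]] := lspan_Kpow_subfield sf (@Kpow_AnnSeq i).
exact: (pLie_closed_subfield pK sf (jacobson_pLie i) At tA).
Qed.

(** If the composite [C] at the next level misses [x], some derivation over [C] is nonzero at [x].
    It is linear over [W i.+2], hence in [F i.+1]; the induction hypothesis puts the [p]-th powers
    from [W i] into [C], so it also lies in the other term of the trivial intersection and must
    vanish. *)
Lemma AnnSeq_compositeS i x : W i x -> composite (W i.+1) (Kpow p i) x.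
Proof.
elim: i x => [|i IHi] x Wx; first by apply: compositer; exists x.
apply: contrapT => nCx; set C := composite _ _ in nCx.
have sfC : is_subfield C by apply: composite_subfield.
have CW y : C y -> W i.+1 y.
  move=> Cy; apply: Cy; [exact: AnnSeq_subfield | exact: AnnSeqS | exact: Kpow_AnnSeq].
have WpC y : W i.+1 y -> C (y ^+ p) by move=> Wy; apply: compositel; apply: AnnSeq_exp.
have [D DC Dx] := Der_separates_Kpow (AnnSeq_subfield i.+1) sfC
  (@Kpow_AnnSeq i.+1) CW WpC Wx nCx.
have [D0 DA DD DM DZ] := DC.
suff D_eq0 : D = @zero_op K by apply: Dx; rewrite D_eq0.
case: jF => _ /(_ i.+1 isT)[_ /(congr1 (@^~ D)) <-]; split.
  rewrite -Der_AnnSeq; split=> // b y Wb; apply: DZ; exact: compositel.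
split=> // _ y [z [Wz ->]]; apply: DZ; apply: (IHi z Wz (fun z => C (z ^+ p))).
- exact: subfield_preim_exp.
- exact: WpC.
- by move=> _ [a ->]; apply: compositer; exists a; rewrite -exprM -expnSr.
Qed.

Lemma AnnSeq_tower : power_tower p W.
Proof.
split=> [|i j ji]; first exact: AnnSeq_subfield.
apply/funext => x; apply/propext; split=> [|Cx].
  (* Going up one level at a time, the powers introduced at level [k + j] already lie in
     [Kpow p j]. *)
  rewrite -(subnK ji); elim: (i - j)%N x => [|k IHk] x Wx; first exact: compositel.
  apply: (IHk x Wx); [exact: composite_subfield | | exact: compositer].
  move=> a /AnnSeq_compositeS; apply; [exact: composite_subfield | exact: compositel |].
  by move=> b /(Kpow_le (leq_addl k j)); apply: compositer.
apply: Cx; [exact: AnnSeq_subfield | | exact: Kpow_AnnSeq].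
rewrite -(subnK ji); elim: (i - j)%N => // k IHk a /AnnSeqS; exact: IHk.
Qed.

End Jacobson.

(** * From algebras of differential operators to power towers *)

Section Algebra.
Variable DD : kset (K -> K).
Hypothesis aDD : K_subalg_Diff (perfection p) DD.
Let W n := const (DD_n p DD n).

Lemma DD_n_End n D : DD_n p DD n D <-> DD D /\ End_over (Kpow p n) D.
Proof.
by split=> -[DDD]; split=> //;
  apply/(Diff_End_overE _ (Kpow_subfield pK n) (fun x (Kx : Kpow p n x) => Kx)).
Qed.

Lemma const_alg_subfield n : is_subfield (W n).
Proof. by apply: (const_subfield (Kpow_subfield pK n)) => D [_ /Diff_End]. Qed.

(** Jacobson-Bourbaki at level [n]: [DD_n p DD n] is an algebra of operators linear over [Kpow p n],
    over which [K] is finite. *)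
Lemma DD_n_eq n : DD_n p DD n = End_over (W n).
Proof.
apply/funext => T; apply/propext; split=> [TD|].
  split; first by case: TD => _ /Diff_End[].
  by move=> l x /constP; apply.
have [s sK] := lspan_Kpow n; have [_ DDmul DDB DDC] := aDD.
apply: (jacobson_bourbaki sK) => [D /DD_n_End[]|a|D E|D E] //.
- by apply/DD_n_End; split=> //; apply: End_over_mulop.
- move=> /DD_n_End[DDD KD] /DD_n_End[DDE KE]; apply/DD_n_End.
  by split; [apply: DDB | apply: End_over_subop].
- move=> /DD_n_End[DDD KD] /DD_n_End[DDE KE]; apply/DD_n_End.
  by split; [apply: DDC | apply: End_over_comp].
Qed.

(** Both sides are constants of operator algebras, so it suffices to compare these: being linear
    over the composite means being linear over [W i], that is lying in level [i] of [DD], and over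
    [Kpow p j]. *)
Lemma alg_tower : power_tower p W.
Proof.
split=> [|i j ji]; first exact: const_alg_subfield.
set C := composite _ _.
have sfC : is_subfield C by apply: composite_subfield.
have [s sK] := lspan_Kpow j.
rewrite -(const_End_over sfC (s := s)); last first.
  by move=> y; apply: lspan_mono (sK y); apply: compositer.
rewrite /W; congr const; apply/funext => D; apply/propext; split=> [/DD_n_End[DDD KD]|CD].
  split; first by case: KD.
  have DW : End_over (W i) D.
    rewrite -DD_n_eq; apply/DD_n_End; split=> //.
    by apply: End_over_sub KD => x; apply: Kpow_le.
  move=> l x Cl; move: x; apply: (Cl (fun l => forall x, D (l * x) = l * D x)).
  - exact: (subfield_linear_locus (const_alg_subfield i) DW).
  - by move=> a Wa y; case: DW => _ ->.
  - by move=> b Kb y; case: KD => _ ->.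
apply/DD_n_End; split.
  have : DD_n p DD i D; last by case.
  by rewrite DD_n_eq; apply: End_over_sub CD; apply: compositel.
by apply: End_over_sub CD; apply: compositer.
Qed.

Lemma alg_tower_to_alg : tower_to_alg W = DD.
Proof.
apply/funext => D; apply/propext; rewrite (tower_to_algP alg_tower); split.
  by move=> [i]; rewrite -DD_n_eq; case.
(* The order of [D] supplies the level: below order [n], [D] is linear over [Kpow p n]. *)
move=> DDD; have [DDiff _ _ _] := aDD; have [n nD] := DDiff D DDD.
exists n; rewrite -DD_n_eq; apply/DD_n_End; split=> //.
exact: diffF_Kpow_linear nD.
Qed.

End Algebra.
End FinitelyGenerated.

(** * Assembly of the two bijections *)

Theorem mainTheorem3 (K : fieldType) (p : nat) :
  p \in [pchar K] ->
  fin_gen_over (perfection (K:=K) p) ->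
  (* (1) -> (2) is well defined, and (2) -> (1) o (1) -> (2) = id *)
  (forall W : nat -> kset K, power_tower p W ->
     jacobson_seq p (fun i => Der (W i) (W i.+1)) /\
     (forall i, AnnSeq (fun j => Der (W j) (W j.+1)) i = W i)) /\
  (* (2) -> (1) is well defined, and (1) -> (2) o (2) -> (1) = id *)
  (forall F : nat -> kset (K -> K), jacobson_seq p F ->
     power_tower p (AnnSeq F) /\
     (forall i, Der (AnnSeq F i) (AnnSeq F i.+1) = F i)) /\
  (* (1) -> (3) is well defined, and (3) -> (1) o (1) -> (3) = id *)
  (forall W : nat -> kset K, power_tower p W ->
     K_subalg_Diff (perfection p) (tower_to_alg W) /\
     (forall n, const (DD_n p (tower_to_alg W) n) = W n)) /\
  (* (3) -> (1) is well defined, and (1) -> (3) o (3) -> (1) = id *)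
  (forall DD : kset (K -> K), K_subalg_Diff (perfection p) DD ->
     power_tower p (fun n => const (DD_n p DD n)) /\
     tower_to_alg (fun n => const (DD_n p DD n)) = DD).
Proof.
move=> pK fgK; split=> [W tW|].
  by split; [apply: tower_jacobson | exact: (tower_AnnSeq pK fgK tW)].
split=> [F jF|].
  by split; [exact: (AnnSeq_tower pK fgK jF) | exact: (Der_AnnSeq pK fgK jF)].
split=> [W tW|DD aDD].
  by split; [exact: (tower_K_subalg pK fgK tW) | exact: (tower_const pK fgK tW)].
by split; [exact: (alg_tower pK fgK aDD) | exact: (alg_tower_to_alg pK fgK aDD)].
Qed.
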